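(* Let $1\le r<n<d$ be integers. For every prime $p$ and every integer $b$ with $1\le b\le\frac{p-1}2$, let $$N_{p,b}=\#\{X\in\mathrm{M}_{d\times n}(\mathbb{Z}) : \|X\|_\infty\le b \text{ and } \mathrm{rank}(X\bmod p)=r\}.$$ Then $$N_{p,b}\asymp_d\max\bigl(b^{dr},\ b^{dn}p^{-(d-r)(n-r)}\bigr),$$ that is, $N_{p,b}$ is bounded above and below by positive constants depending only on $d$ times the right-hand side.
   Context: $\|X\|_\infty$ denotes the maximum of the absolute values of the entries of $X$, and $\mathrm{rank}(X\bmod p)$ is the rank over $\mathbb{F}_p=\mathbb{Z}/p\mathbb{Z}$ of the reduction of $X$ modulo $p$. *)

(* Defs.v *)
From mathcomp Require Import all_boot all_order all_algebra finmap.
From mathcomp Require Import all_classical all_reals.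
From mathcomp Require Import matrix_normedtype.

Set Implicit Arguments.
Unset Strict Implicit.
Unset Printing Implicit Defensive.

Import Order.TTheory GRing.Theory Num.Theory.

Local Open Scope ring_scope.
Local Open Scope classical_set_scope.

Definition rank_mod (p d n : nat) (X : 'M[int]_(d, n)) : nat :=
  \rank (map_mx (intr : int -> 'F_p) X).

Definition bounded_rank_mod (d n r p b : nat) : set 'M[int]_(d, n) :=
  [set X | (mx_norm X <= b%:Z) /\ rank_mod p X = r].

(* [fset_set] is the empty set on infinite sets; this rules that case out. *)
Lemma finite_bounded_rank_mod (d n r p b : nat) :
  finite_set (@bounded_rank_mod d n r p b).
Proof.
pose f (Y : 'M['I_(b + b).+1]_(d, n)) : 'M[int]_(d, n) :=
  \matrix_(i, j) ((Y i j : nat)%:Z - b%:Z).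
apply: (@sub_finite_set _ _ (f @` [set: _])); last first.
  by apply: finite_image; exact: finite_finset.
move=> X [bX _].
have Xij i j : `|X i j| <= b%:Z.
  apply: le_trans bX; rewrite mx_normrE.
  exact: (le_bigmax _ (fun ij : 'I_d * 'I_n => `|X ij.1 ij.2|) (i, j)).
exists (\matrix_(i, j) inord (absz (X i j + b%:Z))) => //.
apply/matrixP => i j; rewrite !mxE.
have := Xij i j; rewrite ler_norml => /andP[lbX ubX].
have X0 : 0 <= X i j + b%:Z by rewrite -lerBlDr sub0r.
rewrite inordK; first by rewrite gez0_abs// addrK.
by rewrite ltnS -lez_nat gez0_abs// PoszD lerD2r.
Qed.

Definition N_pb (d n r p b : nat) : nat :=
  #|` fset_set (@bounded_rank_mod d n r p b)|%fset.

(* Main.v *)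
Require Import Defs.
From mathcomp Require Import all_boot all_order all_algebra.
From mathcomp Require Import all_classical all_reals.
From mathcomp Require Import finmap matrix_normedtype ring lra zify.

Set Implicit Arguments.
Unset Strict Implicit.
Unset Printing Implicit Defensive.

Import Order.TTheory GRing.Theory Num.Theory.
Local Open Scope ring_scope.

(** The term [b ^ (d * r)] is the order of the number of matrices of rank [r]
    over the rationals; the other term is the order of the number expected to
    have rank [r] modulo [p] if entries were equidistributed modulo [p].

    Upper bound.  Sort the matrices by their rank [k] over the rationals; it
    is at least [r], the rank modulo [p], and at most [n].  The rows of X span
    a rational space whose integral points form a primitive lattice L of rank
    [k] in Z^n.  Let [f] pick the [k] columns carrying a maximal minor of that
    space; by Cramer's rule every other column is a combination of these with
    coefficients of absolute value at most 1 ([pivot_factor_le1]).  The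
    projection of L on these columns is a sublattice of Z^k of some index H,
    and has a unique basis in Hermite normal form; lifting it gives a basis B
    of L, and [X = A *m B] with A integral of full rank [k]
    ([reduced_factorization]).  Since L is primitive, B stays free modulo [p],
    so A has rank [r] modulo [p]: its rows lie in the lattice of vectors whose
    reduction lies in an [r]-dimensional space W, which has index
    [p ^ (k - r)].  The rows of X therefore project to points of a lattice of
    index [H * p ^ (k - r)] in Z^k, lie in a box of size [b], and span.  Such a
    lattice has O(b ^ k / (H * p ^ (k - r))) points in the box
    ([sublattice_box_bound]), which gives the [d]-th power of that number for
    the matrices attached to a given (B, W) ([fiber_count]).  There are
    O(p ^ (r * (k - r))) spaces W, and the sum of [H ^- d] over all lattices L
    converges because [d > n] ([lattice_sum]).  So rank [k] contributes
    O(b ^ (d * k) * p ^- ((d - r) * (k - r))) matrices, a geometric progression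
    in [k] whose maximum is reached at [k = r] or at [k = n].

    Lower bound.  Build the transpose of X row by row.  A subspace of dimension
    [t < d] modulo [p] meets the box in at most [(2 b + 1) ^ t] points, so each
    of the first [r] rows can be chosen outside the span of the previous ones
    in at least [b ^ d] ways ([rows_outside_span]).  Each of the [n - r]
    remaining rows is taken in the span, in at least
    [max(1, b ^ d / p ^ (d - r))] ways by the pigeonhole principle
    ([rows_inside_span]).  The constant 1 results. *)

(** * Pivot columns *)

Lemma row_free_colsub_unit (F : fieldType) k n (B : 'M[F]_(k, n)) :
  row_free B -> exists f : {ffun 'I_k -> 'I_n}, colsub f B \in unitmx.
Proof.
move=> freeB; have fullB : row_full B^T by rewrite /row_full mxrank_tr.
exists (fullrankfun fullB).
have -> : colsub (fullrankfun fullB) B = (rowsub (fullrankfun fullB) B^T)^T.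
  by apply/matrixP => i j; rewrite !mxE.
by rewrite unitmx_tr fullrowsub_unit.
Qed.

Lemma pivot_factor_of (F : fieldType) m n k (C : 'M[F]_(m, k)) (B : 'M[F]_(k, n))
    (f : 'I_k -> 'I_n) (Phi := invmx (colsub f B) *m B) :
  colsub f B \in unitmx ->
  colsub f Phi = 1%:M /\ C *m B = colsub f (C *m B) *m Phi.
Proof.
move=> uB; split; first by rewrite -mulmx_colsub mulVmx.
by rewrite -mulmx_colsub -mulmxA mulKVmx.
Qed.

Lemma pivot_factor (F : fieldType) m n k (M : 'M[F]_(m, n)) :
  \rank M = k ->
  exists (f : {ffun 'I_k -> 'I_n}) (Phi : 'M[F]_(k, n)),
    colsub f Phi = 1%:M /\ M = colsub f M *m Phi.
Proof.
move=> <-; have [f uf] := row_free_colsub_unit (row_base_free M).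
have /submxP[C MC] : (M <= row_base M)%MS by rewrite eq_row_base.
exists f, (invmx (colsub f (row_base M)) *m row_base M).
by have := pivot_factor_of C uf; rewrite -MC.
Qed.

(** Expanding along row [i], the replaced column leaves the single entry
    [Phi i j] on an otherwise trivial row: this is Cramer's rule in the form
    used to compare minors. *)
Lemma det_replace_col (F : comNzRingType) k n (Phi : 'M[F]_(k, n))
    (f : {ffun 'I_k -> 'I_n}) i j :
  colsub f Phi = 1%:M ->
  \det (colsub [ffun l => if l == i then j else f l] Phi) = Phi i j.
Proof.
move=> Phif; have Pf a l : Phi a (f l) = (a == l)%:R.
  by have /matrixP/(_ a l) := Phif; rewrite !mxE.
rewrite (expand_det_row _ i) (bigD1 i) //= big1 ?addr0; last first.
  by move=> l li; rewrite !mxE ffunE (negPf li) Pf eq_sym (negPf li) mul0r.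
rewrite !mxE ffunE eqxx /cofactor addnn -signr_odd odd_double mul1r.
suff -> : row' i (col' i (colsub [ffun l => if l == i then j else f l] Phi))
   = 1%:M by rewrite det1 mulr1.
apply/matrixP => a l; rewrite !mxE ffunE.
by rewrite [lift i l == i]eq_sym (negPf (neq_lift _ _)) Pf (inj_eq lift_inj).
Qed.

(** Choosing [f] to maximise the minor in absolute value makes every
    coefficient a quotient of a minor by the largest one. *)
Lemma pivot_factor_le1 (F : realFieldType) m n k (M : 'M[F]_(m, n)) :
  \rank M = k ->
  exists (f : {ffun 'I_k -> 'I_n}) (Phi : 'M[F]_(k, n)),
    [/\ colsub f Phi = 1%:M, M = colsub f M *m Phi
      & forall i j, `|Phi i j| <= 1].
Proof.
move=> <-; set B := row_base M.
have [f0 uf0] := row_free_colsub_unit (row_base_free M).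
have /submxP[C MC] : (M <= B)%MS by rewrite eq_row_base.
pose w (f : {ffun 'I_(\rank M) -> 'I_n}) := `|\det (colsub f B)|.
have [f _ fmax] := @Order.TotalTheory.arg_maxP _ _ _ f0 xpredT w isT.
have uf : colsub f B \in unitmx.
  rewrite unitmxE unitfE -normr_gt0 (lt_le_trans _ (fmax f0 isT)) //.
  by rewrite /w normr_gt0 -unitfE -unitmxE.
have [Phif MPhi] := pivot_factor_of C uf.
exists f, (invmx (colsub f B) *m B); rewrite -MC in MPhi; split=> // i j.
set Phi := invmx _ *m B in Phif MPhi *.
have BPhi : B = colsub f B *m Phi by rewrite mulKVmx.
(* Replacing pivot [i] by column [j] multiplies the minor by [Phi i j]. *)
pose f' := [ffun l => if l == i then j else f l].
have : `|\det (colsub f' B)| <= `|\det (colsub f B)| by exact: fmax.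
rewrite {1}BPhi -mulmx_colsub det_mulmx normrM det_replace_col //.
by rewrite ger_pMr // normr_gt0 -unitfE -unitmxE.
Qed.

(** * Hermite normal forms *)

(** Row style: upper triangular with positive diagonal, the entries above a
    pivot being reduced modulo that pivot.  This makes the matrix unique for
    the lattice spanned by its rows, so that counting lattices amounts to
    counting such matrices. *)
Definition hnf k (T : 'M[int]_k) : Prop :=
  [/\ forall i j : 'I_k, (j < i)%N -> T i j = 0, forall i, 0 < T i i
    & forall i j : 'I_k, (i < j)%N -> 0 <= T i j < T j j].

(** The box [prod_j [0, T j j)], a system of representatives of Z^k modulo
    the row lattice of [T]: see [hnf_unique] and [hnf_reduce]. *)
Definition hnf_residue k (T : 'M[int]_k) (c : 'rV[int]_k) : Prop :=
  forall j, 0 <= c 0 j < T j j.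

(** The coordinates are recovered from left to right: once the first ones
    agree, triangularity makes the next coordinate of the difference a multiple
    of the pivot that is smaller than the pivot. *)
Lemma hnf_unique k (T : 'M[int]_k) (a a' c c' : 'rV[int]_k) :
  hnf T -> hnf_residue T c -> hnf_residue T c' ->
  a *m T + c = a' *m T + c' -> a = a' /\ c = c'.
Proof.
move=> [T0 Tp _] rc rc' E.
have aa : a = a'.
  suff aam (m : nat) (j : 'I_k) : (j < m)%N -> a 0 j = a' 0 j.
    by apply/rowP => j; apply: (aam k).
  elim: m j => // m IH j jm.
  have /rowP/(_ j) : (a - a') *m T = c' - c.
    by rewrite mulmxBl; apply/eqP; rewrite subr_eq addrAC [c' + _]addrC -E addrK.
  rewrite !mxE (bigD1 j) //= big1 ?addr0.
    rewrite !mxE => Ej; apply/eqP; rewrite -subr_eq0; apply: contraT => e0.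
    have : `|c' 0 j - c 0 j| < T j j.
      by rewrite ltr_norml; have := rc j; have := rc' j; lia.
    rewrite -Ej normrM (gtr0_norm (Tp j)) gtr_pMl // ltNge.
    by rewrite -gtz0_ge1 normr_gt0 e0.
  move=> i ij; case: (ltngtP i j) => [ltij|ltji|/val_inj eij].
  - by rewrite !mxE (IH i) ?subrr ?mul0r // (leq_trans ltij).
  - by rewrite T0 ?mulr0.
  - by rewrite eij eqxx in ij.
by split=> //; move: E; rewrite aa => /addrI.
Qed.

(** Euclidean division by the pivots from left to right; correcting
    coordinate [m] does not disturb the earlier ones. *)
Lemma hnf_reduce k (T : 'M[int]_k) (w : 'rV[int]_k) :
  hnf T -> exists v : 'rV[int]_k, hnf_residue T (w - v *m T).
Proof.
move=> [T0 Tp _].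
suff reduce_below (m : nat) : exists v : 'rV[int]_k,
    forall j : 'I_k, (j < m)%N -> 0 <= (w - v *m T) 0 j < T j j.
  by have [v vP] := reduce_below k; exists v => j; apply: vP.
elim: m => [|m [v IH]]; first by exists 0.
case: (ltnP m k) => [mk|km]; last first.
  by exists v => j _; apply: IH; apply: leq_trans km.
pose i := Ordinal mk.
pose h := divz ((w - v *m T) 0 i) (T i i).
exists (v + h *: delta_mx 0 i) => j jm.
have -> : (w - (v + h *: delta_mx 0 i) *m T) 0 j
   = (w - v *m T) 0 j - h * T i j.
  by rewrite mulmxDl -scalemxAl -rowE opprD addrA !mxE.
case: (ltngtP j m) => [lt|gt|/esym e].
- by rewrite T0 // mulr0 subr0 IH.
- by rewrite ltnS leqNgt gt in jm.
have -> : j = i by exact/val_inj.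
by rewrite -[_ - _]/(modz _ _) modz_ge0 ?gt_eqF // ltz_pmod.
Qed.

Lemma hnf_block k (q : int) (w : 'rV[int]_k) (T : 'M[int]_k) :
  0 < q -> hnf T -> hnf_residue T w ->
  hnf (block_mx q%:M w 0 T : 'M[int]_(1 + k)).
Proof.
move=> q0 [T0 Tp Tr] rw; split=> [i j|i|i j].
- case: (split_ordP i) => i' ->; case: (split_ordP j) => j' ->;
    rewrite ?(block_mxEul, block_mxEur, block_mxEdl, block_mxEdr).
  + by rewrite !ord1 ltnn.
  + by rewrite /= ord1.
  + by rewrite mxE.
  + by rewrite /= ltn_add2l; apply: T0.
- case: (split_ordP i) => i' ->; rewrite ?(block_mxEul, block_mxEdr) //.
  by rewrite ord1 mxE.
- case: (split_ordP i) => i' ->; case: (split_ordP j) => j' ->;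
    rewrite ?(block_mxEul, block_mxEur, block_mxEdl, block_mxEdr).
  + by rewrite !ord1 ltnn.
  + by move=> _; rewrite ord1; apply: rw.
  + by rewrite /= ord1.
  + by rewrite /= ltn_add2l; apply: Tr.
Qed.

(** Induction on the dimension: the vectors of [L] with first coordinate 0
    form a lattice of lower rank, and a vector of [L] whose first coordinate
    [q] is positive and minimal completes its basis.  The hypothesis on [H]
    says that [L] has finite index, so that all pivots exist. *)
Lemma hnf_basis k (L : 'rV[int]_k -> Prop) :
  (forall a x y, L x -> L y -> L (a *: x + y)) ->
  (exists2 H : int, 0 < H & forall x, L (H *: x)) ->
  exists2 T : 'M[int]_k, hnf T & forall x, L x <-> exists a, x = a *m T.
Proof.
elim: k L => [|k IH] L Llin [H H0 HL].
  exists 0; first by split=> [[]|[]|[]].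
  move=> x; split=> _; last by rewrite [x]thinmx0 -(scaler0 _ H); apply: HL.
  by exists 0; rewrite [LHS]thinmx0 [RHS]thinmx0.
change k.+1 with (1 + k)%N in L, Llin, HL |- *.
have L0 : L 0 by rewrite -(scaler0 _ H); apply: HL.
have LZ a x : L x -> L (a *: x) by move=> Lx; rewrite -[_ *: _]addr0; apply: Llin.
have LD x y : L x -> L y -> L (x + y).
  by move=> Lx Ly; rewrite -[x]scale1r; apply: Llin.
have [||T hT TP] := IH (fun x => L (row_mx 0 x)).
- by move=> a x y Lx Ly; have := Llin a _ _ Lx Ly;
    rewrite scale_row_mx add_row_mx scaler0 addr0.
- by exists H => // x; have := HL (row_mx 0 x); rewrite scale_row_mx scaler0.
pose P q := (0 < q)%N && `[< exists x, L (row_mx (q%:Z)%:M x) >].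
have exP : exists q, P q.
  exists `|H|%N; rewrite /P absz_gt0 gt_eqF //=; apply/asboolP; exists 0.
  by have := HL (row_mx 1%:M 0); rewrite scale_row_mx scaler0 scale_scalar_mx
    mulr1 gtz0_abs.
case: (ex_minnP exP) => q /andP[q0 /asboolP[w0 Lw0]] qmin.
have [v rv] := hnf_reduce w0 hT.
set w := w0 - v *m T in rv.
have Lw : L (row_mx (q%:Z)%:M w).
  have -> : row_mx (q%:Z)%:M w = (-1) *: row_mx 0 (v *m T) + row_mx (q%:Z)%:M w0.
    by rewrite scale_row_mx add_row_mx scaler0 add0r scaleN1r addrC.
  by apply: Llin => //; apply/TP; exists v.
exists (block_mx (q%:Z)%:M w 0 T); first exact: hnf_block.
move=> x; rewrite -[x]hsubmxK; move: (lsubmx x) (rsubmx x) => x0 x1.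
split=> [Lx|[a ->]]; last first.
  rewrite -[a]hsubmxK mul_row_block mulmx0 addr0.
  move: (mx11_scalar (lsubmx a)); move: (lsubmx a 0 0) => a0 ->.
  rewrite -[X in row_mx X]addr0 -add_row_mx.
  apply: LD; last by apply/TP; exists (rsubmx a).
  rewrite -mul_mx_row mul_scalar_mx; exact: LZ.
pose h := divz (x0 0 0) q; pose rm := modz (x0 0 0) q.
have q0Z : q%:Z != 0 by rewrite eqz_nat -lt0n.
have Lr : L (row_mx (rm%:M) (x1 - h *: w)).
  have -> : row_mx (rm%:M) (x1 - h *: w)
      = (- h) *: row_mx (q%:Z)%:M w + row_mx x0 x1.
    rewrite scale_row_mx add_row_mx !scaleNr [- _ + x1]addrC; congr row_mx.
    rewrite [x0]mx11_scalar -scaleNr scale_scalar_mx -raddfD /=; congr _%:M.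
    by rewrite /rm /modz -/h mulNr addrC.
  exact: Llin.
(* The remainder of the first coordinate modulo [q] vanishes by minimality. *)
have rm0 : rm = 0.
  apply/eqP; case: eqP => // /eqP rm1.
  have rge : 0 <= rm by rewrite modz_ge0.
  have : P `|rm|%N.
    rewrite /P absz_gt0 rm1 /=; apply/asboolP; exists (x1 - h *: w).
    by rewrite gez0_abs.
  move/qmin; rewrite -lez_nat gez0_abs // leNgt.
  by rewrite ltz_pmod.
move: Lr; rewrite rm0 raddf0 => /TP[a' Ea'].
exists (row_mx h%:M a'); rewrite mul_row_block mulmx0 addr0 -Ea'.
rewrite mul_scalar_mx scale_scalar_mx mul_scalar_mx addrC subrK.
congr row_mx; rewrite [x0]mx11_scalar; congr _%:M.
by rewrite {1}(divz_eq (x0 0 0) q) -/h -/rm rm0 addr0.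
Qed.

(** * Primitive lattice of a rational row space *)

Notation ratmx := (map_mx (intr : int -> rat)).

Lemma ratmx_inj m n : injective (fun A : 'M[int]_(m, n) => ratmx A).
Proof.
move=> A B /matrixP E; apply/matrixP => i j.
by have := E i j; rewrite !mxE => /intr_inj.
Qed.

Lemma clear_denominators m n (Phi : 'M[rat]_(m, n)) :
  exists2 H : int, 0 < H & exists Z : 'M[int]_(m, n), H%:~R *: Phi = ratmx Z.
Proof.
exists (\prod_(ij : 'I_m * 'I_n) denq (Phi ij.1 ij.2)).
  by apply: prodr_gt0 => ij _; apply: denq_gt0.
exists (\matrix_(i, j) (numq (Phi i j) *
   \prod_(ij : 'I_m * 'I_n | ij != (i, j)) denq (Phi ij.1 ij.2))).
apply/matrixP => i j; rewrite !mxE (bigD1 (i, j)) //= !rmorphM /=.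
by rewrite [_ * Phi i j]mulrC mulrA -numqE.
Qed.

(** [colsub f B] is the Hermite basis of the projection on the pivot columns,
    and the bound on [Phi] is the maximality of the corresponding minor. *)
Definition reduced_basis k n (f : 'I_k -> 'I_n) (B : 'M[int]_(k, n)) : Prop :=
  [/\ injective f, hnf (colsub f B)
    & exists2 Phi : 'M[rat]_(k, n), (forall i j, `|Phi i j| <= 1)
      & ratmx B = ratmx (colsub f B) *m Phi].

Lemma Fpmx_lift p m n (v : 'M['F_p]_(m, n)) :
  map_mx intr (map_mx (fun x : 'F_p => (x : nat)%:Z) v) = v.
Proof. by apply/matrixP => i j; rewrite !mxE; apply: natr_Zp. Qed.

(** The lattice [L] of the proof consists of the vectors [x] such that
    [x *m Phi] is integral, [X = colsub f X *m Phi] being the pivot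
    factorization over the rationals; it is the projection on the pivot columns
    of the primitive lattice attached to X.  Primitivity is what keeps the
    rank of [A] modulo [p] equal to that of X: if [p] divides [a *m B], then
    the quotient is again in the lattice, hence [p] divides [a]. *)
Lemma reduced_factorization p d n k (X : 'M[int]_(d, n)) :
  prime p -> \rank (ratmx X) = k ->
  exists (f : {ffun 'I_k -> 'I_n}) (B : 'M[int]_(k, n)) (A : 'M[int]_(d, k)),
  [/\ reduced_basis f B, X = A *m B, \rank (ratmx A) = k
    & rank_mod p X = rank_mod p A].
Proof.
move=> pp rkX; have [f [Phi [Phif XPhi Phi1]]] := pivot_factor_le1 rkX.
have cs : colsub f (ratmx X) = ratmx (colsub f X) by rewrite map_mxsub.
rewrite cs in XPhi.
have Pf a l : Phi a (f l) = (a == l)%:R.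
  by have /matrixP/(_ a l) := Phif; rewrite !mxE.
pose L (x : 'rV[int]_k) := exists y : 'rV[int]_n, ratmx x *m Phi = ratmx y.
(* Clearing the denominators of [Phi] shows that [L] has finite index. *)
have [||T hT LT] := @hnf_basis k L.
- move=> a x y [x' Ex] [y' Ey]; exists (a *: x' + y').
  by rewrite !map_mxD !map_mxZ mulmxDl -scalemxAl Ex Ey.
- have [H H0 [Z EZ]] := clear_denominators Phi.
  exists H => // x; exists (x *m Z).
  by rewrite map_mxZ -scalemxAl scalemxAr EZ map_mxM.
have /choice [A0 A0P] : forall i, exists a, row i (colsub f X) = a *m T.
  move=> i; apply/LT; exists (row i X).
  by rewrite !map_row -row_mul -XPhi.
have /choice [B0 B0P] : forall i, L (row i T).
  by move=> i; apply/LT; exists (delta_mx 0 i); rewrite rowE.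
pose A := \matrix_i A0 i; pose B := \matrix_i B0 i.
have XfA : colsub f X = A *m T.
  by apply/row_matrixP => i; rewrite A0P row_mul rowK.
have TB : ratmx T *m Phi = ratmx B.
  by apply/row_matrixP => i; rewrite row_mul -!map_row B0P rowK.
have Bf : colsub f B = T.
  apply: ratmx_inj; rewrite /= map_mxsub -TB.
  by rewrite -[mxsub _ _ _]mulmx_colsub Phif mulmx1.
have XAB : X = A *m B.
  by apply: ratmx_inj; rewrite /= XPhi XfA !map_mxM -mulmxA TB.
exists f, B, A; split=> //.
- split; first 1 last.
  + by rewrite Bf.
  + by exists Phi; rewrite // Bf.
  + move=> i j fij; apply/eqP; apply: contraTT isT => ij.
    have := Pf i i; rewrite fij Pf eqxx (negPf ij) => /eqP.
    by rewrite eq_sym oner_eq0.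
- apply/eqP; rewrite eqn_leq rank_leq_col -{1}rkX XAB map_mxM.
  exact: mxrankM_maxl.
rewrite /rank_mod XAB map_mxM; apply: mxrankMfree; apply: inj_row_free => v vB.
pose a := map_mx (fun x : 'F_p => (x : nat)%:Z) v.
have va : v = map_mx intr a by rewrite Fpmx_lift.
have [y aBy] : exists y, a *m B = p%:Z *: y.
  exists (map_mx (fun x => (x %/ p)%Z) (a *m B)).
  apply/matrixP => i j; rewrite !mxE mulrC divzK //.
  rewrite (dvdz_pcharf (pchar_Fp pp)).
  have /matrixP/(_ i j) := vB; rewrite va -map_mxM !mxE => E.
  by rewrite -E; apply/eqP; congr _%:~R; rewrite mxE.
have aTy : a *m T = p%:Z *: colsub f y.
  rewrite -Bf mulmx_colsub aBy.
  by apply/matrixP => i j; rewrite !mxE.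
have pQ0 : (p%:Z)%:~R != 0 :> rat by rewrite intr_eq0 eqz_nat -lt0n prime_gt0.
have /LT[a' Ea'] : L (colsub f y).
  exists y; apply: (scalerI pQ0); rewrite scalemxAl -!map_mxZ -aTy -aBy.
  by rewrite !map_mxM -mulmxA TB.
have res0 : hnf_residue T 0 by case: hT => _ Tp _ j; rewrite mxE lexx Tp.
rewrite va; have [|-> _] := @hnf_unique _ T a (p%:Z *: a') 0 0 hT res0 res0.
  by rewrite !addr0 aTy Ea' scalemxAl.
apply/matrixP => i j; rewrite !mxE; apply/eqP.
by rewrite -(dvdz_pcharf (pchar_Fp pp)) dvdz_mulr.
Qed.

(** * Counting by injections *)

Lemma size_le_card (K : eqType) (F : finType) (h : K -> F) (A : {pred F})
    (s : seq K) :
  uniq s -> {in s &, injective h} -> {in s, forall x, h x \in A} ->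
  (size s <= #|A|)%N.
Proof.
move=> us hinj hA; have um : uniq (map h s) by rewrite map_inj_in_uniq.
rewrite -(size_map h) -(card_uniqP um); apply: fintype.subset_leq_card.
by apply/fintype.subsetP => _ /mapP[x xs ->]; apply: hA.
Qed.

Lemma card_familyE (aT rT : finType) (F : aT -> {pred rT}) :
  #|(family F : {pred {ffun aT -> rT}})| = (\prod_x #|F x|)%N.
Proof. by rewrite card_family foldrE big_map enumT. Qed.

Lemma card_family_zero_on (aT : finType) (p : nat) (A : {pred aT}) : prime p ->
  #|(family (fun x => if x \in A then pred1 0 else predT)
      : {pred {ffun aT -> 'F_p}})| = (p ^ (#|aT| - #|A|))%N.
Proof.
move=> pp; rewrite card_familyE (bigID (mem A)) /= big1 ?mul1n; last first.
  by move=> x ->; rewrite card1.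
rewrite (eq_bigr (fun=> p)) => [|x /negPf ->]; last by rewrite card_Fp.
by rewrite prod_nat_const -(cardC A) addKn.
Qed.

Lemma card_ord_lt M q : (q <= M)%N -> #|[pred c : 'I_M | (c < q)%N]| = q.
Proof.
move=> qM; have winj : injective (widen_ord qM).
  by move=> i j /(congr1 val) /= ij; apply: val_inj.
rewrite -[RHS]card_ord -(card_codom winj); apply: eq_card => c.
rewrite !inE; apply/idP/codomP => [cq|[i ->]] //=.
by exists (Ordinal cq); apply: val_inj.
Qed.

(** * Boxes and Hermite residues *)

Definition in_box b m n (M : 'M[int]_(m, n)) : Prop :=
  forall i j, `|M i j| <= b%:Z.

Lemma box_code_bound b (x : int) :
  `|x| <= b%:Z -> (absz (x + b%:Z)%R < (b + b).+1)%N.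
Proof. lia. Qed.

Lemma box_code_inj b (x y : int) : `|x| <= b%:Z -> `|y| <= b%:Z ->
  absz (x + b%:Z) = absz (y + b%:Z) -> x = y.
Proof. lia. Qed.

Lemma hnf_det k (T : 'M[int]_k) : hnf T -> \det T = \prod_i T i i.
Proof.
move=> [T0 _ _]; rewrite -det_tr det_trig.
  by apply: eq_bigr => i _; rewrite mxE.
by apply/is_trig_mxP => i j ij; rewrite mxE T0.
Qed.

Lemma hnf_unit k (T : 'M[int]_k) : hnf T -> ratmx T \in unitmx.
Proof.
move=> hT; rewrite unitmxE unitfE det_map_mx intr_eq0 hnf_det //.
by apply/prodf_neq0 => i _; case: hT => _ Tp _; rewrite gt_eqF.
Qed.

(** Write [x] with rational coefficients on the rows of [M] and round them
    down: the remainder is a combination of the rows with coefficients in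
    [[0, 1)]. *)
Lemma reduce_mod_rows d k b (M : 'M[int]_(d, k)) (x : 'rV[int]_k) :
  in_box b M -> \rank (ratmx M) = k ->
  exists z : 'rV[int]_d, in_box (d * b) (x - z *m M).
Proof.
move=> bM rM; have /submxP[q xq] : (ratmx x <= ratmx M)%MS.
  by apply: submx_full; rewrite /row_full rM.
exists (map_mx Num.floor q) => i j; rewrite ord1.
rewrite -(ler_int rat) intr_norm.
have -> : ((x - map_mx Num.floor q *m M) 0 j)%:~R =
  \sum_l (q 0 l - (Num.floor (q 0 l))%:~R) * (M l j)%:~R :> rat.
  have /matrixP/(_ 0 j) := xq; rewrite !mxE rmorphB /= => ->.
  rewrite rmorph_sum /= -sumrB; apply: eq_bigr => l _.
  by rewrite !mxE rmorphM /= mulrBl.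
apply: le_trans (ler_norm_sum _ _ _) _.
have -> : (d * b)%N%:~R = \sum_(l < d) b%:R :> rat.
  by rewrite sumr_const card_ord -[RHS]mulr_natl -natrM.
apply: ler_sum => l _; rewrite normrM -[leRHS]mul1r; apply: ler_pM => //.
  have /andP[le_q lt_q] := floor_itv (q 0 l).
  rewrite ger0_norm ?subr_ge0 // lerBlDl (le_trans (ltW lt_q)) //.
  by rewrite intrD.
by rewrite -intr_norm -[b%:R]/((b%:Z)%:~R) ler_int.
Qed.

(** * Points of a sublattice in a box *)

Notation Fpmx p := (map_mx (intr : int -> 'F_p)).

(** When [colsub g Psi = 1%:M], this says that the rows of [M] lie in the row
    space of [Psi]: their coordinates on [Psi] can only be those found in the
    columns [g]. *)
Definition row_pattern (F : fieldType) m r k (g : 'I_r -> 'I_k)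
    (Psi : 'M[F]_(r, k)) (M : 'M[F]_(m, k)) : Prop :=
  M = colsub g M *m Psi.

(** A linear projection along the row space of [Psi], with values supported
    outside the columns [g]; it turns membership in that row space into an
    additive condition, see [row_patternP]. *)
Definition pattern_defect (F : fieldType) r k (g : 'I_r -> 'I_k)
    (Psi : 'M[F]_(r, k)) : 'M[F]_k := 1%:M - colsub g 1%:M *m Psi.

Lemma mul_pattern_defect (F : fieldType) m r k (g : 'I_r -> 'I_k)
    (Psi : 'M[F]_(r, k)) (M : 'M[F]_(m, k)) :
  M *m pattern_defect g Psi = M - colsub g M *m Psi.
Proof. by rewrite mulmxBr mulmx1 mulmxA mulmx_colsub mulmx1. Qed.

Lemma row_patternP (F : fieldType) m r k (g : 'I_r -> 'I_k)
    (Psi : 'M[F]_(r, k)) (M : 'M[F]_(m, k)) :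
  row_pattern g Psi M <-> M *m pattern_defect g Psi = 0.
Proof.
rewrite mul_pattern_defect /row_pattern; split=> [<-|/eqP]; first exact: subrr.
by rewrite subr_eq0 => /eqP.
Qed.

Lemma pattern_inj (F : fieldType) r k (g : 'I_r -> 'I_k) (Psi : 'M[F]_(r, k)) :
  colsub g Psi = 1%:M -> injective g.
Proof.
move=> gPsi i j gij; apply/eqP; apply: contraTT isT => ij.
have /matrixP/(_ i i) := gPsi; have /matrixP/(_ i j) := gPsi.
rewrite !mxE gij eqxx (negPf ij) => -> /eqP.
by rewrite eq_sym oner_eq0.
Qed.

(** The vectors of [s] belong to a lattice of index [p ^ (k - r)] in
    Z^k, whose image by [T] has index [p ^ (k - r) * \det T].  The rows of
    [A *m T] are points of that image lattice which span, so every
    class of Z^k modulo it has a representative of size at most [d * b].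
    Adding these representatives to the points of [s] gives pairwise distinct
    integer points in a box of size [(d + 1) * b], hence the bound. *)
Lemma sublattice_box_bound p d k r b (T : 'M[int]_k) (g : 'I_r -> 'I_k)
    (Psi : 'M['F_p]_(r, k)) (A : 'M[int]_(d, k)) (s : seq 'rV[int]_k) :
  prime p -> (0 < b)%N -> hnf T -> colsub g Psi = 1%:M ->
  in_box b (A *m T) -> \rank (ratmx A) = k -> row_pattern g Psi (Fpmx p A) ->
  uniq s ->
  {in s, forall a, in_box b (a *m T) /\ row_pattern g Psi (Fpmx p a)} ->
  (size s * (\prod_i absz (T i i)) * p ^ (k - r) <= ((2 * d + 3) * b) ^ k)%N.
Proof.
move=> pp b0 hT gPsi bA rA patA us sP.
have ginj := pattern_inj gPsi.
have rAT : \rank (ratmx (A *m T)) = k.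
  by rewrite map_mxM mxrankMfree // row_free_unit hnf_unit.
pose M := (\max_i absz (T i i))%N.
pose lift (e : {ffun 'I_k -> 'F_p}) : 'rV[int]_k := \row_j (e j : nat)%:Z.
pose resid (c : {ffun 'I_k -> 'I_M}) : 'rV[int]_k := \row_j (c j : nat)%:Z.
have /choice[z zP] : forall ec : {ffun 'I_k -> 'F_p} * {ffun 'I_k -> 'I_M},
  exists z : 'rV[int]_d,
    in_box (d * b) (lift ec.1 *m T + resid ec.2 - z *m (A *m T)).
  by move=> ec; apply: reduce_mod_rows.
(* The point attached to the [i]-th vector of [s] and to the class [ec] is
   [y i ec]; subtracting [z ec] rows of [A *m T] brings it into the box. *)
pose coef (i : 'I_(size s)) ec := nth 0 s i + lift ec.1 - z ec *m A.
pose y (i : 'I_(size s)) ec := coef i ec *m T + resid ec.2.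
have by_ i ec : in_box (d * b + b) (y i ec).
  have -> : y i ec = (lift ec.1 *m T + resid ec.2 - z ec *m (A *m T))
                     + nth 0 s i *m T.
    by rewrite /y /coef mulmxBl mulmxDl mulmxA [RHS]addrC !addrA addrAC.
  have [bs _] := sP _ (mem_nth 0 (ltn_ord i)).
  move=> u v; rewrite mxE PoszD; apply: le_trans (ler_normD _ _) _.
  by apply: lerD; [apply: zP | apply: bs].
(* Vectors vanishing on the columns [g] represent the classes modulo the
   row space of [Psi], and [C] represents the classes modulo [T]. *)
pose E := (family (fun j => if j \in codom g then pred1 0 else predT)
            : {pred {ffun 'I_k -> 'F_p}}).
pose C := (family (fun j => [pred c : 'I_M | (c < absz (T j j))%N])
            : {pred {ffun 'I_k -> 'I_M}}).
have cE : #|E| = (p ^ (k - r))%N.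
  by rewrite card_family_zero_on // card_codom // !card_ord.
have cC : #|C| = (\prod_i absz (T i i))%N.
  rewrite card_familyE; apply: eq_bigr => i _; apply: card_ord_lt.
  exact: (leq_bigmax i).
pose D := [pred u : 'I_(size s) * ({ffun 'I_k -> 'F_p} * {ffun 'I_k -> 'I_M})
           | (u.2.1 \in E) && (u.2.2 \in C)].
have cD : #|D| = (size s * (p ^ (k - r) * \prod_i absz (T i i)))%N.
  rewrite -[size s in RHS]card_ord -cE -cC -!cardX.
  by apply: eq_card => u; rewrite !inE.
rewrite mulnAC -mulnA -cD.
pose code u : {ffun 'I_k -> 'I_((d * b + b) + (d * b + b)).+1} :=
  [ffun j => inord (absz (y u.1 u.2 0 j + (d * b + b)%N%:Z)%R)].
apply: (@leq_trans #|{: {ffun 'I_k -> 'I_((d * b + b) + (d * b + b)).+1}}|).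
  apply: (@leq_card_in _ _ code) => [[i ec] [i' ec']] /andP[/= Ee Cc] /andP[/= Ee' Cc'].
  move=> /ffunP eqc.
  have eqy : y i ec = y i' ec'.
    apply/rowP => j; have := eqc j; rewrite !ffunE => /(congr1 val) /=.
    rewrite !inordK ?(box_code_bound (by_ _ _ _ _)) //.
    by apply: box_code_inj; apply: by_.
  have rC c : c \in C -> hnf_residue T (resid c).
    move=> /familyP cin j; rewrite mxE; have := cin j; rewrite inE.
    case: hT => _ Tp _ cj; have T_j := Tp j.
    by rewrite lez_nat /= -[T j j]gtz0_abs.
  have [ecoef ec2] := hnf_unique hT (rC _ Cc) (rC _ Cc') eqy.
  pose P := pattern_defect g Psi.
  have coefP j v : v.1 \in E -> Fpmx p (coef j v) *m P = \row_l v.1 l.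
    move=> /familyP Ev.
    have [_ /row_patternP sPj] := sP _ (mem_nth 0 (ltn_ord j)).
    rewrite map_mxB map_mxD map_mxM mulmxBl mulmxDl sPj add0r.
    have AP : Fpmx p A *m P = 0 by apply/row_patternP.
    rewrite -mulmxA AP mulmx0 subr0 mul_pattern_defect.
    have -> : Fpmx p (lift v.1) = \row_l v.1 l.
      by apply/rowP => l; rewrite !mxE; apply: natr_Zp.
    have -> : colsub g (\row_l v.1 l) = 0.
      apply/rowP => l; rewrite !mxE; have := Ev (g l).
      by rewrite codom_f inE => /eqP.
    by rewrite mul0mx subr0.
  have ee : ec.1 = ec'.1.
    have := coefP i ec Ee; rewrite ecoef coefP // => /rowP Er.
    by apply/ffunP => l; have := Er l; rewrite !mxE.
  have cc : ec.2 = ec'.2.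
    apply/ffunP => l; apply: val_inj; have /rowP/(_ l) := ec2.
    by rewrite !mxE => -[].
  have eec : ec = ec' by case: (ec) (ec') ee cc => [? ?] [? ?] /= -> ->.
  congr (_, _) => //; apply: val_inj; apply/eqP.
  rewrite -(nth_uniq 0 (ltn_ord i) (ltn_ord i') us); apply/eqP.
  by move: ecoef; rewrite /coef eec => /addIr /addIr.
rewrite card_ffun !card_ord; case: (posnP k) => [->|k0]; first by rewrite !expn0.
rewrite leq_exp2r //; nia.
Qed.

(** The index in Z^k of the projection of the row lattice of [B] on the
    pivot columns, as [colsub f B] is triangular. *)
Definition covolume k n (f : 'I_k -> 'I_n) (B : 'M[int]_(k, n)) : nat :=
  (\prod_i absz (B i (f i)))%N.

(** The rows of the coefficient matrices [A] all belong to one set [S] to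
    which [sublattice_box_bound] applies, any single [A] providing the spanning
    rows; and [X] is determined by the [d] rows of its [A]. *)
Lemma fiber_count p d n k r b (f : 'I_k -> 'I_n) (B : 'M[int]_(k, n))
    (g : 'I_r -> 'I_k) (Psi : 'M['F_p]_(r, k)) (s : seq 'M[int]_(d, n)) :
  prime p -> (0 < b)%N -> reduced_basis f B -> colsub g Psi = 1%:M -> uniq s ->
  {in s, forall X, in_box b X /\ exists A,
     [/\ X = A *m B, \rank (ratmx A) = k & row_pattern g Psi (Fpmx p A)]} ->
  (size s * (covolume f B * p ^ (k - r)) ^ d <= ((2 * d + 3) * b) ^ (k * d))%N.
Proof.
move=> pp b0 [_ hT _] gPsi us sP.
case: (posnP (size s)) => [->//|s0].
have /choice[al alP] : forall X, exists A, X \in s ->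
    [/\ X = A *m B, \rank (ratmx A) = k & row_pattern g Psi (Fpmx p A)].
  move=> X; case: (boolP (X \in s)) => [/sP[_ [A AP]]|_]; first by exists A.
  by exists 0.
pose S := undup [seq row i (al X) | X <- s, i <- enum 'I_d].
have memS X i : X \in s -> row i (al X) \in S.
  by move=> Xs; rewrite mem_undup; apply: allpairs_f => //; rewrite mem_enum.
have alT X : X \in s -> al X *m colsub f B = colsub f X.
  by move=> /alP[XA _ _]; rewrite mulmx_colsub -XA.
have core : (size S * covolume f B * p ^ (k - r) <= ((2 * d + 3) * b) ^ k)%N.
  pose X0 := nth 0 s 0; have X0s : X0 \in s by apply: mem_nth.
  have [_ rA patA] := alP _ X0s.
  have := @sublattice_box_bound p d k r b (colsub f B) g Psi (al X0) S
            pp b0 hT gPsi _ rA patA (undup_uniq _) _.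
  have -> : (\prod_i absz (colsub f B i i) = covolume f B)%N.
    by apply: eq_bigr => i _; rewrite mxE.
  apply.
    by have [bX _] := sP _ X0s; rewrite alT // => i j; rewrite mxE; apply: bX.
  move=> a; rewrite mem_undup => /allpairsP[[X i] /= [Xs _ ->]].
  have [XA _ patX] := alP _ Xs; have [bX _] := sP _ Xs; split.
    by rewrite -row_mul alT // => u v; rewrite !mxE; apply: bX.
  rewrite /row_pattern map_row {1}patX row_mul; congr (_ *m _).
  by apply/matrixP => u v; rewrite !mxE.
have szS : (size s <= size S ^ d)%N.
  pose h X : {ffun 'I_d -> 'I_(size S).+1} :=
    [ffun i => inord (index (row i (al X)) S)].
  pose F := (family (fun _ => [pred c : 'I_(size S).+1 | (c < size S)%N])
            : {pred {ffun 'I_d -> 'I_(size S).+1}}).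
  have <- : #|F| = (size S ^ d)%N.
    rewrite card_familyE (eq_bigr (fun=> size S)) ?prod_nat_const ?card_ord //.
    by move=> i _; rewrite card_ord_lt.
  have idx X i : X \in s -> (index (row i (al X)) S < size S)%N.
    by move=> Xs; rewrite index_mem memS.
  apply: (@size_le_card _ _ h) => // [X Y Xs Ys|X Xs]; last first.
    by apply/familyP => i; rewrite ffunE inE inordK ?idx // ltnW // ltnS idx.
  move=> /ffunP eqh; suff eqal : al X = al Y.
    by have [-> _ _] := alP _ Xs; have [YA _ _] := alP _ Ys; rewrite eqal -YA.
  apply/row_matrixP => i; have := eqh i; rewrite !ffunE => /(congr1 val) /=.
  rewrite !inordK ?ltnS ?(ltnW (idx _ _ _)) // => /(congr1 (nth 0 S)).
  by rewrite !nth_index ?memS.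
rewrite expnM; apply: leq_trans (leq_mul szS (leqnn _)) _.
rewrite -expnMn mulnA; case: (posnP d) => [->//|d0].
by rewrite leq_exp2r.
Qed.

(** * The sum over lattices *)

Lemma absz_ltn (x : int) (q : nat) : 0 <= x < q%:Z -> (absz x < q)%N.
Proof. lia. Qed.

Lemma absz_inj_ge0 (x y : int) : 0 <= x -> 0 <= y -> absz x = absz y -> x = y.
Proof. lia. Qed.

Lemma absz_modz_ltn (x : int) (q : nat) : (0 < q)%N -> (absz (modz x q) < q)%N.
Proof.
move=> q0; apply: absz_ltn; rewrite modz_ge0 ?ltz_pmod //.
by rewrite gt_eqF.
Qed.

(** Two integers in an interval of length [2 q] are separated by their
    residues modulo [3 q]. *)
Lemma eq_of_eqmod3 (x y : int) (q : nat) :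
  (0 < q)%N -> `|x - y| <= (2 * q)%N%:Z ->
  absz (modz x (3 * q)%N) = absz (modz y (3 * q)%N) -> x = y.
Proof.
move=> q0 xy; have q3 : (3 * q)%N%:Z != 0 by lia.
move=> /(absz_inj_ge0 (modz_ge0 x q3) (modz_ge0 y q3)) emod.
have := divz_eq x (3 * q)%N; have := divz_eq y (3 * q)%N; rewrite emod.
move: (divz x _) (divz y _) (modz _ _) => u v w ey ex.
have {ex ey} exy : x - y = (u - v) * (3 * q)%N%:Z.
  by rewrite ex ey mulrBl opprD addrACA subrr addr0.
suff : u = v by move=> uv; move: exy; rewrite uv subrr mul0r; lia.
by move: xy; rewrite exy; nia.
Qed.

(** The first factor counts the entries above the diagonal in the pivot
    columns.  For the second one, solve [B = colsub f B *m Phi] from the last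
    row upwards in a column outside the pivots: once the lower coefficients are
    known, the bound on [Phi] confines the next entry of [B] to an interval of
    length [2 q i], so its residue modulo [3 q i] determines it. *)
Lemma count_reduced_bases n k (f : 'I_k -> 'I_n) (q : 'I_k -> nat)
    (s : seq 'M[int]_(k, n)) :
  uniq s ->
  {in s, forall B, reduced_basis f B /\ forall i, B i (f i) = (q i)%:Z} ->
  (size s <= (\prod_(j < k) q j ^ j) * (\prod_(i < k) (3 * q i)) ^ (n - k))%N.
Proof.
move=> us sP; case: (posnP (size s)) => [->//|s0].
have [[finj _ _] _] := sP _ (mem_nth 0 s0).
have q0 i : (0 < q i)%N.
  have [[_ [_ Tp _] _] qE] := sP _ (mem_nth 0 s0).
  by have := Tp i; rewrite mxE qE.
have [m q3m] : exists m, forall i, (3 * q i <= m)%N.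
  by exists (\sum_i 3 * q i)%N => i; rewrite (bigD1 i) //= leq_addr.
pose M := m.+1; have q3M i : (3 * q i < M)%N by apply: q3m.
have qM i : (q i < M)%N by apply: leq_ltn_trans (q3M i); rewrite leq_pmull.
(* [F1] codes the entries above the diagonal of the pivot columns, [F2] the
   residues of the other columns; entries that are already determined are
   coded by 0. *)
pose F1 := (family (fun ij : 'I_k * 'I_k =>
     [pred c : 'I_M | (c < if (ij.1 < ij.2)%N then q ij.2 else 1)%N])
   : {pred {ffun 'I_k * 'I_k -> 'I_M}}).
pose F2 := (family (fun ij : 'I_k * 'I_n =>
     [pred c : 'I_M | (c < if ij.2 \in codom f then 1 else 3 * q ij.1)%N])
   : {pred {ffun 'I_k * 'I_n -> 'I_M}}).
have <- : #|F1| = (\prod_(j < k) q j ^ j)%N.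
  rewrite card_familyE.
  transitivity (\prod_(ij : 'I_k * 'I_k)
                  if (ij.1 < ij.2)%N then q ij.2 else 1)%N.
    apply: eq_bigr => ij _; apply: card_ord_lt; case: ifP => // _.
    exact: ltnW.
  rewrite -(pair_bigA _ (fun i j : 'I_k => if (i < j)%N then q j else 1%N)) /=.
  rewrite exchange_big /=; apply: eq_bigr => j _.
  by rewrite -big_mkcond prod_nat_const card_ord_lt // ltnW.
have <- : #|F2| = ((\prod_(i < k) (3 * q i)) ^ (n - k))%N.
  rewrite card_familyE.
  transitivity (\prod_(ij : 'I_k * 'I_n)
                  if ij.2 \in codom f then 1 else 3 * q ij.1)%N.
    apply: eq_bigr => ij _; apply: card_ord_lt; case: ifP => // _.
    exact: ltnW.
  rewrite -(pair_bigA _ (fun i j => if j \in codom f then 1%N else (3 * q i)%N)) /=.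
  rewrite exchange_big /= (bigID (mem (codom f))) /= big1 ?mul1n; last first.
    by move=> j ->; rewrite big1.
  rewrite (eq_bigr (fun=> \prod_(i < k) (3 * q i)))%N; last first.
    by move=> j /negPf ->.
  rewrite prod_nat_const; congr (_ ^ _)%N.
  have := cardC [in codom f]; rewrite card_codom // !card_ord => En.
  by rewrite -[n in RHS]En addKn.
rewrite -cardX.
pose h (B : 'M[int]_(k, n)) : {ffun 'I_k * 'I_k -> 'I_M} * {ffun 'I_k * 'I_n -> 'I_M} :=
  ([ffun ij : 'I_k * 'I_k =>
     inord (if (ij.1 < ij.2)%N then absz (B ij.1 (f ij.2)) else 0%N)],
   [ffun ij : 'I_k * 'I_n => inord (if ij.2 \in codom f then 0%N
                      else absz (modz (B ij.1 ij.2) (3 * q ij.1)%N))]).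
have h1 B (ij : 'I_k * 'I_k) : B \in s ->
    ((if (ij.1 < ij.2)%N then absz (B ij.1 (f ij.2)) else 0%N) <
       if (ij.1 < ij.2)%N then q ij.2 else 1)%N.
  move=> /sP[[_ [_ _ Tr] _] qE]; case: ifP => // /Tr.
  by rewrite !mxE qE; apply: absz_ltn.
have h2 B (ij : 'I_k * 'I_n) : B \in s ->
    ((if ij.2 \in codom f then 0%N
      else absz (modz (B ij.1 ij.2) (3 * q ij.1)%N)) <
       if ij.2 \in codom f then 1 else 3 * q ij.1)%N.
  move=> Bs; case: ifP => // _.
  by apply: absz_modz_ltn; rewrite muln_gt0 q0.
have lt1 (i j : 'I_k) c : (c < if (i < j)%N then q j else 1)%N -> (c < M)%N.
  by case: ifP => _ /leq_trans -> //; apply: ltnW.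
have lt2 (i : 'I_k) (j : 'I_n) c :
    (c < if j \in codom f then 1 else 3 * q i)%N -> (c < M)%N.
  by case: ifP => _ /leq_trans -> //; apply: ltnW.
apply: (@size_le_card _ _ h) => // [B B' Bs B's|B Bs]; last first.
  rewrite inE; apply/andP; split; apply/familyP => ij; rewrite ffunE inE.
    by rewrite inordK ?h1 //; apply: (lt1 ij.1 ij.2); apply: h1.
  by rewrite inordK ?h2 //; apply: (lt2 ij.1 ij.2); apply: h2.
move=> [/ffunP e1 /ffunP e2].
have [[_ [T0 Tp Tr] [Phi Phi1 BPhi]] qE] := sP _ Bs.
have [[_ [T0' Tp' Tr'] [Phi' Phi1' BPhi']] qE'] := sP _ B's.
have eT i l : B i (f l) = B' i (f l).
  case: (ltngtP i l) => [il|li|/val_inj ->]; last by rewrite qE qE'.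
  - have := e1 (i, l); rewrite !ffunE /= => /(congr1 val) /=.
    have l1 := lt1 i l _ (h1 B (i, l) Bs); have l2 := lt1 i l _ (h1 B' (i, l) B's).
    move: l1 l2; rewrite /= il => l1 l2; rewrite !inordK //.
    have /andP[B0 _] := Tr i l il; have /andP[B0' _] := Tr' i l il.
    by move: B0 B0'; rewrite !mxE; apply: absz_inj_ge0.
  - by have := T0 i l li; have := T0' i l li; rewrite !mxE => -> ->.
apply/matrixP => i j; case: (boolP (j \in codom f)) => [/codomP[l ->]//|jf].
suff both (w : nat) (a : 'I_k) : (k - a <= w)%N -> B a j = B' a j /\ Phi a j = Phi' a j.
  by have [] := both k i (leq_subr _ _).
elim: w a => [|w IH] a aw.
  by move: aw; rewrite leqNgt subn_gt0 ltn_ord.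
have expand (C : 'M[int]_(k, n)) (X : 'M[rat]_(k, n)) :
    ratmx C = ratmx (colsub f C) *m X -> (forall l : 'I_k, (l < a)%N -> C a (f l) = 0) ->
    (C a j)%:~R = (C a (f a))%:~R * X a j +
       \sum_(l < k | (a < l)%N) (C a (f l))%:~R * X l j.
  move=> /matrixP/(_ a j) E C0; move: E; rewrite !mxE => ->.
  rewrite (bigD1 a) //= mxE mxE; congr (_ + _).
  rewrite big_mkcond [RHS]big_mkcond; apply: eq_bigr => l _; rewrite !mxE.
  case: (ltngtP a l) => [al|la|/val_inj ->]; last by rewrite eqxx.
    by case: eqP => // al'; rewrite al' ltnn in al.
  by rewrite C0 // mul0r; case: ifP.
have lowB (l : 'I_k) : (l < a)%N -> B a (f l) = 0 by move/T0; rewrite mxE.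
have lowB' (l : 'I_k) : (l < a)%N -> B' a (f l) = 0 by move/T0'; rewrite mxE.
have EB := expand _ _ BPhi lowB; have EB' := expand _ _ BPhi' lowB'.
have eqtail : \sum_(l < k | (a < l)%N) (B a (f l))%:~R * Phi l j =
   \sum_(l < k | (a < l)%N) (B' a (f l))%:~R * Phi' l j.
  apply: eq_bigr => l al; rewrite eT; congr (_ * _).
  have kl : (k - l <= w)%N by rewrite -ltnS (leq_trans _ aw) // ltn_sub2l.
  by have [] := IH l kl.
have diff : (B a j - B' a j)%:~R = (q a)%:R * (Phi a j - Phi' a j) :> rat.
  by rewrite intrB EB EB' eqtail qE qE' mulrBr; ring.
have le2 : `|B a j - B' a j| <= (2 * q a)%:Z.
  rewrite -(ler_int rat) intr_norm diff normrM ger0_norm // mulnC PoszM intrM.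
  rewrite ler_wpM2l // (le_trans (ler_normB _ _)) //.
  by have := Phi1 a j; have := Phi1' a j; lra.
have eqB : B a j = B' a j.
  have := e2 (a, j); rewrite !ffunE /= => /(congr1 val) /=.
  have l1 := lt2 a j _ (h2 B (a, j) Bs); have l2 := lt2 a j _ (h2 B' (a, j) B's).
  move: l1 l2; rewrite /= (negPf jf) => l1 l2; rewrite !inordK //.
  exact: eq_of_eqmod3 (q0 a) le2.
split=> //; move: diff; rewrite eqB subrr => /esym/eqP.
rewrite mulf_eq0 pnatr_eq0 gtn_eqF //= subr_eq0 => /eqP.
done.
Qed.

(** The value at 0 is set to 0 so that sums can run over all diagonals, those
    with a zero entry included. *)
Definition inv_sq (R : realFieldType) (x : nat) : R :=
  if x == 0%N then 0 else x%:R ^- 2.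

(** Comparison with the telescoping sum of [1 / (x * (x + 1))]. *)
Lemma sum_inv_sq_le2 (R : realFieldType) M : \sum_(x < M) inv_sq R x <= 2.
Proof.
case: M => [|[|m]]; first by rewrite big_ord0.
  by rewrite big_ord_recl big_ord0 /inv_sq /= addr0.
suff : \sum_(x < m.+2) inv_sq R x <= 2 - m.+1%:R^-1.
  by move=> /le_trans; apply; rewrite lerBlDr lerDl invr_ge0.
elim: m => [|m IH].
  by rewrite !big_ord_recl big_ord0 /inv_sq /= expr1n invr1; lra.
rewrite big_ord_recr /=; apply: le_trans (lerD IH (lexx _)) _.
rewrite {1}/inv_sq /= -lerBrDl -subr_ge0.
have -> : 2 - m.+2%:R^-1 - (2 - m.+1%:R^-1) - m.+2%:R ^- 2 =
   m.+1%:R^-1 * m.+2%:R ^- 2 :> R.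
  have m1 : m.+1%:R != 0 :> R by rewrite pnatr_eq0.
  have m2 : m.+1%:R + 1 != 0 :> R by rewrite natr1 pnatr_eq0.
  have -> : m.+2%:R = m.+1%:R + 1 :> R by rewrite natr1.
  by move: (m.+1%:R) m1 m2 => t t0 t1; field; rewrite t0 t1.
by rewrite mulr_ge0 ?invr_ge0 ?exprn_ge0.
Qed.

(** Group the bases by their diagonal [q].  By [count_reduced_bases] each
    diagonal contributes at most a constant times the product of
    [q_j ^ (j + (n - k) - d)], and the exponents are at most [-2] because
    [j < k] and [n < d]; the sum over [q] is then a product of [k] convergent
    series. *)
Lemma lattice_sum (R : realFieldType) n k d (f : 'I_k -> 'I_n)
    (s : seq 'M[int]_(k, n)) :
  (n < d)%N -> uniq s -> {in s, forall B, reduced_basis f B} ->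
  \sum_(B <- s) (covolume f B)%:R ^- d <= (3 ^ (k * n) * 2 ^ k)%:R :> R.
Proof.
move=> nd us sP.
have [m Bm] : exists m, {in s, forall (B : 'M[int]_(k, n)) i, (absz (B i (f i)) <= m)%N}.
  exists (\max_(B <- s) \max_i absz ((B : 'M[int]_(k, n)) i (f i)))%N => B Bs i.
  apply: leq_trans (leq_bigmax_seq _ Bs isT); exact: (leq_bigmax i).
pose q (B : 'M[int]_(k, n)) : {ffun 'I_k -> 'I_m.+1} :=
  [ffun i => inord (absz (B i (f i)))].
rewrite (partition_big q xpredT) //=.
apply: (@le_trans _ _ (\sum_(c : {ffun 'I_k -> 'I_m.+1})
    (3 ^ (k * n))%:R * \prod_i inv_sq R (c i))).
  apply: ler_sum => c _; rewrite -big_filter.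
  set sc := [seq _ <- _ | _].
  have scP : {in sc, forall B, reduced_basis f B /\
      forall i, B i (f i) = (c i : nat)%:Z}.
    move=> B; rewrite mem_filter => /andP[/eqP qB Bs]; split; first exact: sP.
    move=> i; have [_ [_ Tp _] _] := sP _ Bs; have := Tp i; rewrite mxE => B0.
    have := congr1 (fun h : {ffun _ -> _} => val (h i)) qB.
    by rewrite ffunE /= inordK ?ltnS ?Bm // => <-; rewrite gtz0_abs.
  have -> : \sum_(B <- sc) (covolume f B)%:R ^- d =
     (size sc)%:R * (\prod_i c i)%:R ^- d :> R.
    rewrite -sum1_size natr_sum mulr_suml; apply: eq_big_seq => B Bsc.
    rewrite mul1r; congr (_%:R ^- d); apply: eq_bigr => i _.
    by have [_ ->] := scP _ Bsc.
  case: (posnP (size sc)) => [->|sc0].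
    rewrite mul0r mulr_ge0 //; apply: prodr_ge0 => i _; rewrite /inv_sq.
    by case: ifP => // _; rewrite invr_ge0 exprn_ge0.
  have [[finj _ _] _] := scP _ (mem_nth 0 sc0).
  have kn : (k <= n)%N by have := leq_card f finj; rewrite !card_ord.
  have c0 i : (0 < c i)%N.
    have [[_ [_ Tp _] _] cE] := scP _ (mem_nth 0 sc0).
    by have := Tp i; rewrite mxE cE.
  have cnt := @count_reduced_bases n k f (fun i => c i) sc (filter_uniq _ us) scP.
  apply: (@le_trans _ _ (((\prod_(j < k) c j ^ j) *
      (\prod_(i < k) (3 * c i)) ^ (n - k))%:R * (\prod_i c i)%:R ^- d)).
    by rewrite ler_wpM2r ?invr_ge0 ?exprn_ge0 ?ler_nat.
  have -> : (\prod_(i < k) (3 * c i) = 3 ^ k * \prod_i c i)%N.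
    by rewrite big_split /= prod_nat_const card_ord.
  rewrite expnMn mulnCA natrM -mulrA -expnM.
  apply: ler_pM => //; first by rewrite mulr_ge0 ?invr_ge0 ?exprn_ge0.
    by rewrite ler_nat leq_exp2l // leq_mul2l leq_subr orbT.
  rewrite natrM natrX !natr_prod -!prodrXl -prodfV -!big_split /=.
  apply: ler_prod => i _; rewrite /inv_sq gtn_eqF //.
  have ci : 0 < (c i)%:R :> R by rewrite ltr0n.
  rewrite natrX -exprD mulr_ge0 ?invr_ge0 ?exprn_ge0 //=.
  rewrite ler_pdivrMr ?exprn_gt0 // mulrC ler_pdivlMr ?exprn_gt0 //.
  (* The exponents satisfy [i + (n - k) + 2 <= d]. *)
  rewrite -exprD ler_weXn2l ?ler1n //.
  have := ltn_ord i; lia.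
rewrite -mulr_sumr natrM; apply: ler_wpM2l => //.
rewrite -(bigA_distr_bigA (fun (i : 'I_k) (x : 'I_m.+1) => inv_sq R x)).
rewrite natrX -[k in leRHS]card_ord -prodr_const; apply: ler_prod => i _.
rewrite sum_inv_sq_le2 andbT; apply: sumr_ge0 => x _; rewrite /inv_sq.
by case: ifP => // _; rewrite invr_ge0 exprn_ge0.
Qed.

(** * Upper bound *)

Lemma size_union_bound (K : eqType) (I : finType) (rel : K -> pred I) (s : seq K) :
  {in s, forall x, exists i, rel x i} ->
  (size s <= \sum_i size [seq x <- s | rel x i])%N.
Proof.
move=> cover; under eq_bigr do rewrite size_filter -sum1_count big_mkcond.
rewrite exchange_big /= -sum1_size big_seq [leqRHS]big_seq.
apply: leq_sum => x /cover[i xi].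
by rewrite (bigD1 i) //= xi.
Qed.

Lemma size_fibers (K P : eqType) (beta : K -> P) (s : seq K) :
  size s =
  (\sum_(y <- undup (map beta s)) size [seq x <- s | beta x == y])%N.
Proof.
under eq_bigr do rewrite size_filter -sum1_count big_mkcond.
rewrite exchange_big /= -sum1_size; apply: eq_big_seq => x xs.
rewrite -big_mkcond sum1_count (eq_count (a2 := pred1 (beta x))).
  by rewrite count_uniq_mem ?undup_uniq // mem_undup map_f.
by move=> y /=; rewrite eq_sym.
Qed.

(** Only the columns outside [g] are free.  A space of dimension [r] with
    pivot columns [g] has exactly one such matrix as a basis. *)
Lemma card_patterns p r k (g : 'I_r -> 'I_k) : prime p ->
  (#|[pred Psi : 'M['F_p]_(r, k) | colsub g Psi == 1%:M]|
     <= p ^ (r * (k - r)))%N.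
Proof.
move=> pp; set D := [pred Psi | _].
case: (pickP D) => [Psi0 D0|D0]; last by rewrite (eq_card0 D0).
have ginj : injective g by move: D0; rewrite inE => /eqP/pattern_inj.
pose Z := [pred ij : 'I_r * 'I_k | ij.2 \in codom g].
have cZ : #|Z| = (r * r)%N.
  transitivity #|[predX (predT : pred 'I_r) & [in codom g]]|.
    by apply: eq_card => ij; rewrite !inE.
  by rewrite cardX card_codom // !card_ord.
have <- : #|(family (fun ij => if ij \in Z then pred1 0 else predT)
      : {pred {ffun 'I_r * 'I_k -> 'F_p}})| = (p ^ (r * (k - r)))%N.
  by rewrite card_family_zero_on // cZ card_prod !card_ord mulnBr.
rewrite cardE; pose h (Psi : 'M['F_p]_(r, k)) : {ffun 'I_r * 'I_k -> 'F_p} :=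
  [ffun ij => if ij \in Z then 0 else Psi ij.1 ij.2].
apply: (@size_le_card _ _ h); first exact: enum_uniq.
  move=> Psi Psi'; rewrite !mem_enum !inE => /eqP E /eqP E' /ffunP eqh.
  apply/matrixP => i j; case: (boolP (j \in codom g)) => [/codomP[l ->]|jg].
    by move: E'; rewrite -E => /matrixP/(_ i l); rewrite !mxE.
  by have := eqh (i, j); rewrite !ffunE !inE /= (negPf jg).
move=> Psi _; apply/familyP => ij; rewrite ffunE.
by case: ifP => // _; rewrite inE.
Qed.

Definition rank_constant d n k r : nat :=
  (n ^ k * (3 ^ (k * n) * 2 ^ k) * k ^ r * (2 * d + 3) ^ (k * d))%N.

(** Summation of [fiber_count] over the spaces modulo [p], parametrised by
    [(g, Psi)], then over the reduced bases [B], then over the pivot columns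
    [f]. *)
Lemma count_rational_rank (R : realFieldType) (p d n k r b : nat)
    (s : seq 'M[int]_(d, n)) :
  prime p -> (0 < b)%N -> (n < d)%N -> uniq s ->
  {in s, forall X, [/\ in_box b X, \rank (ratmx X) = k & rank_mod p X = r]} ->
  (size s)%:R <= (rank_constant d n k r)%:R * b%:R ^+ (d * k)
                 * p%:R ^+ (r * (k - r)) / p%:R ^+ (d * (k - r)) :> R.
Proof.
move=> pp b0 nd us sP.
have p0 : 0 < p%:R :> R by rewrite ltr0n prime_gt0.
have factor X : X \in s ->
   exists fB : {ffun 'I_k -> 'I_n} * 'M[int]_(k, n),
   reduced_basis fB.1 fB.2 /\ exists A, [/\ X = A *m fB.2,
      \rank (ratmx A) = k & rank_mod p X = rank_mod p A].
  move=> /sP[_ rX _]; have [f [B [A [? ? ? ?]]]] := reduced_factorization pp rX.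
  by exists (f, B); split=> //; exists A.
case: (posnP (size s)) => [->|s0].
  by rewrite !mulr_ge0 ?invr_ge0 ?exprn_ge0.
have /choice[be beP] : forall X, exists fB : {ffun 'I_k -> 'I_n} * 'M[int]_(k, n),
   X \in s -> reduced_basis fB.1 fB.2 /\ exists A, [/\ X = A *m fB.2,
      \rank (ratmx A) = k & rank_mod p X = rank_mod p A].
  move=> X; case: (boolP (X \in s)) => [/factor[fB ?]|_]; first by exists fB.
  by have [fB _] := factor _ (mem_nth 0 s0); exists fB.
pose K : R := ((2 * d + 3) * b)%:R ^+ (k * d) / p%:R ^+ (d * (k - r)).
pose rel X (gP : {ffun 'I_r -> 'I_k} * 'M['F_p]_(r, k)) :=
  (colsub gP.1 gP.2 == 1%:M) && `[< exists A, [/\ X = A *m (be X).2,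
      \rank (ratmx A) = k & row_pattern gP.1 gP.2 (Fpmx p A)] >].
have fiber f B : (B \in undup [seq (be X).2 | X <- s & (be X).1 == f]) ->
  (size [seq X <- [seq X <- s | (be X).1 == f] | (be X).2 == B])%:R <=
   (k ^ r * p ^ (r * (k - r)))%:R * (K * (covolume f B)%:R ^- d).
  rewrite mem_undup => /mapP[X0]; rewrite mem_filter => /andP[/eqP X0f X0s BX0].
  have [redB _] := beP _ X0s; rewrite X0f -BX0 in redB.
  set sB := [seq _ <- _ | _].
  have usB : uniq sB by rewrite !filter_uniq.
  have sBP X : X \in sB -> X \in s /\ be X = (f, B).
    rewrite !mem_filter => /and3P[/eqP XB /eqP Xf Xs]; split=> //.
    by rewrite [be X]surjective_pairing XB Xf.
  have cover : {in sB, forall X, exists gP, rel X gP}.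
    move=> X Xs; have [Xs' beX] := sBP _ Xs; have [_ [A [XA rA rpA]]] := beP _ Xs'.
    have [_ _ rX] := sP _ Xs'; rewrite rX in rpA.
    have [g [Psi [gPsi patA]]] := pivot_factor (esym rpA).
    exists (g, Psi); rewrite /rel /= gPsi eqxx /=; apply/asboolP.
    by exists A; split.
  have := size_union_bound cover; rewrite -(ler_nat R) => /le_trans; apply.
  rewrite natr_sum.
  apply: (@le_trans _ _ (\sum_(gP : {ffun 'I_r -> 'I_k} * 'M['F_p]_(r, k)
              | colsub gP.1 gP.2 == 1%:M) K * (covolume f B)%:R ^- d)).
    rewrite [leRHS]big_mkcond; apply: ler_sum => gP _.
    case: ifP => [/eqP gPsi|ngP]; last first.
      rewrite (eq_filter (a2 := pred0)) ?filter_pred0 // => X.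
      by rewrite /rel ngP.
    have := @fiber_count p d n k r b f B gP.1 gP.2
              [seq X <- sB | rel X gP] pp b0 redB gPsi (filter_uniq _ usB) _.
    set N := size _ => bnd.
    have {bnd} : (N * (covolume f B * p ^ (k - r)) ^ d
                    <= ((2 * d + 3) * b) ^ (k * d))%N.
      apply: bnd => X; rewrite mem_filter => /andP[/andP[_ /asboolP[A]]].
      move=> [XA rA patA] /sBP[Xs beX]; rewrite beX in XA.
      by have [bX _ _] := sP _ Xs; split=> //; exists A.
    have cov0 : 0 < (covolume f B)%:R :> R.
      rewrite ltr0n; apply: prodn_gt0 => i; rewrite absz_gt0.
      by case: redB => _ [_ Tp _] _; have := Tp i; rewrite mxE => /gt_eqF ->.
    rewrite -(ler_nat R) /K -mulrA -invfM ler_pdivlMr ?mulr_gt0 ?exprn_gt0 //.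
    by rewrite natrM !natrX natrM natrX exprMn -exprM [(d * _)%N]mulnC [_ ^+ d * _]mulrC.
  rewrite sumr_const -[leLHS]mulr_natl ler_wpM2r //.
    by rewrite !mulr_ge0 ?invr_ge0 ?exprn_ge0.
  rewrite ler_nat -sum1_card.
  rewrite -(pair_big_dep xpredT (fun (g : {ffun 'I_r -> 'I_k}) (Psi : 'M['F_p]_(r, k)) =>
    colsub g Psi == 1%:M) (fun _ _ => 1%N)) /=.
  apply: (@leq_trans (\sum_(g : {ffun 'I_r -> 'I_k}) p ^ (r * (k - r)))).
    by apply: leq_sum => g _; rewrite sum1_card card_patterns.
  by rewrite sum_nat_const card_ffun !card_ord.
have fiber_f f : (size [seq X <- s | (be X).1 == f])%:R <=
   (k ^ r * p ^ (r * (k - r)))%:R * K * (3 ^ (k * n) * 2 ^ k)%:R.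
  rewrite (size_fibers (fun X => (be X).2)) natr_sum.
  apply: (@le_trans _ _ (\sum_(B <- undup [seq (be X).2 | X <- s & (be X).1 == f])
     (k ^ r * p ^ (r * (k - r)))%:R * K * (covolume f B)%:R ^- d)).
    rewrite big_seq [leRHS]big_seq; apply: ler_sum => B Bs.
    by rewrite -mulrA; apply: fiber.
  rewrite -mulr_sumr ler_wpM2l //.
    by rewrite !mulr_ge0 ?invr_ge0 ?exprn_ge0.
  apply: lattice_sum => //; first exact: undup_uniq.
  move=> B; rewrite mem_undup => /mapP[X]; rewrite mem_filter.
  by move=> /andP[/eqP <- /beP[redX _]] ->.
have cover_f : {in s, forall X, exists f, (be X).1 == f}.
  by move=> X _; exists (be X).1.
have := size_union_bound cover_f; rewrite -(ler_nat R) natr_sum.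
move=> /le_trans; apply.
apply: (@le_trans _ _ (\sum_(f : {ffun 'I_k -> 'I_n})
   (k ^ r * p ^ (r * (k - r)))%:R * K * (3 ^ (k * n) * 2 ^ k)%:R)).
  by apply: ler_sum => f _; apply: fiber_f.
rewrite sumr_const card_ffun !card_ord -[leLHS]mulr_natl /K /rank_constant.
rewrite !natrM !natrX !exprMn [(k * d)%N]mulnC.
rewrite le_eqVlt; apply/orP; left; apply/eqP; ring.
Qed.

Lemma rank_mod_le_rational p d n (X : 'M[int]_(d, n)) :
  prime p -> (rank_mod p X <= \rank (ratmx X))%N.
Proof.
move=> pp; have [f [B [A [_ _ _ ->]]]] := @reduced_factorization p d n _ X pp erefl.
exact: rank_leq_col.
Qed.

Definition uniform_constant d : nat :=
  (d ^ d * (3 ^ (d * d) * 2 ^ d) * d ^ d * (2 * d + 3) ^ (d * d))%N.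

Lemma rank_constant_le d n k r : (n < d)%N -> (k <= n)%N -> (r <= n)%N ->
  (rank_constant d n k r <= uniform_constant d)%N.
Proof.
move=> nd kn rn; have d0 : (0 < d)%N by apply: leq_ltn_trans nd.
have kd : (k <= d)%N by apply: leq_trans kn (ltnW nd).
have leq_pow a e : (a <= d)%N -> (e <= d)%N -> (a ^ e <= d ^ d)%N.
  move=> ad ed; apply: (@leq_trans (d ^ e)); last by rewrite leq_pexp2l.
  by case: e {ed} => // e; rewrite leq_exp2r.
have rd : (r <= d)%N by apply: leq_trans rn (ltnW nd).
apply: leq_mul; last by rewrite leq_pexp2l ?addn_gt0 ?orbT // leq_mul.
apply: leq_mul; last exact: leq_pow.
apply: leq_mul; first by apply: leq_pow => //; apply: ltnW.
by apply: leq_mul; rewrite leq_pexp2l // leq_mul // ltnW.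
Qed.

(** With [t = b ^ d / p ^ (d - r)], rational rank [k] contributes at most a
    constant times [b ^ (d * r) * t ^ (k - r)], and [t ^ (k - r)] is at most 1
    or at most [t ^ (n - r)]. *)
Lemma rank_mod_count_upper (R : realFieldType) (p d n r b : nat)
    (s : seq 'M[int]_(d, n)) :
  prime p -> (0 < b)%N -> (r < n)%N -> (n < d)%N -> uniq s ->
  {in s, forall X, in_box b X /\ rank_mod p X = r} ->
  (size s)%:R <= (d * uniform_constant d)%:R *
    Num.max (b%:R ^+ (d * r))
      (b%:R ^+ (d * n) * p%:R ^- ((d - r) * (n - r))) :> R.
Proof.
move=> pp b0 rn nd us sP.
have p0 : 0 < p%:R :> R by rewrite ltr0n prime_gt0.
have bp0 : 0 < b%:R :> R by rewrite ltr0n.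
set Mx := Num.max _ _; have Mx0 : 0 <= Mx by rewrite le_max exprn_ge0.
have cover : {in s, forall X, exists k : 'I_n.+1, \rank (ratmx X) == k}.
  move=> X _; have rX : (\rank (ratmx X) < n.+1)%N by rewrite ltnS rank_leq_col.
  by exists (Ordinal rX).
have := size_union_bound cover; rewrite -(ler_nat R) natr_sum.
move=> /le_trans; apply.
apply: (@le_trans _ _ (\sum_(k < n.+1) (uniform_constant d)%:R * Mx)); last first.
  rewrite sumr_const card_ord -[leLHS]mulr_natl mulrA -natrM ler_wpM2r //.
  by rewrite ler_nat leq_mul.
apply: ler_sum => k _; set sk := [seq _ <- _ | _].
have skP : {in sk, forall X, [/\ in_box b X, \rank (ratmx X) = k & rank_mod p X = r]}.
  by move=> X; rewrite mem_filter => /andP[/eqP rX /sP[bX mX]].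
case: (posnP (size sk)) => [->|sk0]; first by rewrite mulr_ge0.
have rk : (r <= k)%N.
  have [_ <- <-] := skP _ (mem_nth 0 sk0); exact: rank_mod_le_rational.
have := count_rational_rank R pp b0 nd (filter_uniq _ us) skP.
move=> /le_trans; apply.
rewrite -!mulrA; apply: ler_pM => //.
- by rewrite !mulr_ge0 ?invr_ge0 ?exprn_ge0.
- by rewrite ler_nat rank_constant_le // -1?ltnS // ltnW.
pose t : R := b%:R ^+ d / p%:R ^+ (d - r).
have t0 : 0 <= t by rewrite mulr_ge0 ?invr_ge0 ?exprn_ge0.
have drn m : b%:R ^+ (d * r) * t ^+ m
   = b%:R ^+ (d * (r + m)) * p%:R ^- ((d - r) * m) :> R.
  by rewrite /t exprMn mulrA -exprM -exprD -mulnDr exprVn -exprM.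
have -> : b%:R ^+ (d * k) * (p%:R ^+ (r * (k - r)) / p%:R ^+ (d * (k - r))) =
   b%:R ^+ (d * r) * t ^+ (k - r) :> R.
  rewrite drn subnKC //; congr (_ * _).
  have -> : (d * (k - r) = r * (k - r) + (d - r) * (k - r))%N.
    by rewrite -mulnDl subnKC // ltnW // (ltn_trans rn).
  by rewrite exprD invfM mulrA divff ?mul1r // expf_neq0 // gt_eqF.
have -> : Mx = Num.max (b%:R ^+ (d * r)) (b%:R ^+ (d * r) * t ^+ (n - r)).
  by rewrite drn subnKC // ltnW.
have kn : (k <= n)%N by rewrite -ltnS.
case: (leP t 1) => t1.
  rewrite le_max; apply/orP; left.
  by rewrite ger_pMr ?exprn_gt0 // exprn_ile1.
rewrite le_max; apply/orP; right.
by rewrite ler_wpM2l ?exprn_ge0 // ler_weXn2l ?ltW // leq_sub2r.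
Qed.

(** * Lower bound *)

Lemma box_decode_bound (b c : nat) :
  (c < (b + b).+1)%N -> `|c%:Z - b%:Z| <= b%:Z.
Proof. lia. Qed.

Lemma box_codeK (b : nat) (x : int) :
  `|x| <= b%:Z -> (absz (x + b%:Z)%R)%:Z - b%:Z = x.
Proof. lia. Qed.

Lemma dist_below_bound (b c c' : nat) :
  (c < b.+1)%N -> (c' < b.+1)%N -> `|c%:Z - c'%:Z| <= b%:Z.
Proof. lia. Qed.

Definition box_rows b d : seq 'rV[int]_d :=
  [seq (\row_j ((v j : nat)%:Z - b%:Z)) | v : {ffun 'I_d -> 'I_(b + b).+1}].

Lemma box_rows_uniq b d : uniq (box_rows b d).
Proof.
rewrite map_inj_uniq ?enum_uniq // => v w /rowP E; apply/ffunP => j.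
by apply: val_inj; have := E j; rewrite !mxE => /addIr [].
Qed.

Lemma size_box_rows b d : size (box_rows b d) = ((b + b).+1 ^ d)%N.
Proof. by rewrite size_map -cardE card_ffun !card_ord. Qed.

Lemma mem_box_rows b d (y : 'rV[int]_d) : y \in box_rows b d <-> in_box b y.
Proof.
split=> [/mapP[v _ ->] i j|by_].
  by rewrite mxE; apply: box_decode_bound.
apply/mapP; exists [ffun j => inord (absz (y 0 j + b%:Z))]; rewrite ?mem_enum //.
apply/rowP => j; rewrite mxE ffunE inordK ?box_codeK //.
exact/box_code_bound/by_.
Qed.

(** [Psi] has [t] rows, so its row space, which contains that of [M], is equal
    to it. *)
Lemma pattern_submx (F : fieldType) m d t (M : 'M[F]_(m, d)) (g : 'I_t -> 'I_d)
    (Psi : 'M[F]_(t, d)) (y : 'rV[F]_d) :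
  \rank M = t -> colsub g Psi = 1%:M -> row_pattern g Psi M ->
  (y <= M)%MS <-> row_pattern g Psi y.
Proof.
move=> rM gPsi patM; have MPsi : (M <= Psi)%MS by rewrite patM submxMl.
have eqM : (M :=: Psi)%MS.
  apply/eqmxP; rewrite -(geq_leqif (mxrank_leqif_eq MPsi)) rM.
  exact: rank_leq_row.
rewrite eqM; split=> [/submxP[u ->]|->]; last exact: submxMl.
by rewrite /row_pattern -mulmx_colsub gPsi mulmx1.
Qed.

Lemma Fpmx_box_inj p b m n (A B : 'M[int]_(m, n)) :
  prime p -> (b + b < p)%N -> in_box b A -> in_box b B ->
  Fpmx p A = Fpmx p B -> A = B.
Proof.
move=> pp bp bA bB /matrixP E; apply/matrixP => i j; have := E i j.
rewrite !mxE => /eqP; rewrite -subr_eq0 -intrB -(dvdz_pcharf (pchar_Fp pp)).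
move=> /dvdzP[z Ez]; have := bA i j; have := bB i j.
move: (A i j) (B i j) Ez => u v Ez bv bu; clear -Ez bv bu bp.
suff z0 : z = 0 by move: Ez; rewrite z0 mul0r => /eqP; rewrite subr_eq0 => /eqP.
nia.
Qed.

(** The coordinates [g] determine a vector of the span modulo [p], and
    vectors of the box are determined modulo [p]; so at most [(2 b + 1) ^ t]
    vectors of the box are in the span. *)
Lemma rows_outside_span p b d m (Y : 'M[int]_(m, d)) :
  prime p -> (0 < b)%N -> (b + b < p)%N -> (rank_mod p Y < d)%N ->
  exists s : seq 'rV[int]_d,
    [/\ uniq s, (b ^ d <= size s)%N
      & {in s, forall y, in_box b y /\ ~~ (Fpmx p y <= Fpmx p Y)%MS}].
Proof.
move=> pp b0 bp rd; set t := rank_mod p Y in rd.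
have [g [Psi [gPsi patY]]] := pivot_factor (erefl t : \rank (Fpmx p Y) = t).
pose inside (y : 'rV[int]_d) := (Fpmx p y <= Fpmx p Y)%MS.
exists [seq y <- box_rows b d | predC inside y]; split.
- by rewrite filter_uniq // box_rows_uniq.
- have total : (size [seq y <- box_rows b d | inside y] +
      size [seq y <- box_rows b d | predC inside y] = (b + b).+1 ^ d)%N.
    by rewrite !size_filter count_predC size_box_rows.
  suff few : (size [seq y <- box_rows b d | inside y] <= (b + b).+1 ^ t)%N.
    have le_t : ((b + b).+1 ^ t <= (b + b).+1 ^ d.-1)%N.
      by rewrite leq_pexp2l // -ltnS (ltn_predK rd).
    have split_d : ((b + b).+1 ^ d = (b + b).+1 ^ d.-1 + (b + b) * (b + b).+1 ^ d.-1)%N.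
      by rewrite -mulSn -expnS (ltn_predK rd).
    have ge_d : (b ^ d <= (b + b) * (b + b).+1 ^ d.-1)%N.
      rewrite -{1}(ltn_predK rd) expnS leq_mul ?leq_addr //.
      by case: (d.-1) => // e; rewrite leq_exp2r // -addnS leq_addr.
    rewrite -(leq_add2l (size [seq y <- box_rows b d | inside y])) total split_d.
    by rewrite leq_add // (leq_trans few).
  pose code (y : 'rV[int]_d) : {ffun 'I_t -> 'I_(b + b).+1} :=
    [ffun i => inord (absz (y 0 (g i) + b%:Z))].
  have -> : ((b + b).+1 ^ t = #|{: {ffun 'I_t -> 'I_(b + b).+1}}|)%N.
    by rewrite card_ffun !card_ord.
  apply: (@size_le_card _ _ code) => //; first by rewrite filter_uniq // box_rows_uniq.
  move=> y y'; rewrite !mem_filter => /andP[iny /mem_box_rows by_].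
  move=> /andP[iny' /mem_box_rows by_'] /ffunP eqc.
  have pat := pattern_submx _ (erefl t : \rank (Fpmx p Y) = t) gPsi patY.
  move/pat: iny => paty; move/pat: iny' => paty'.
  apply: (Fpmx_box_inj pp bp) => //; rewrite paty paty'; congr (_ *m _).
  apply/rowP => i; rewrite !mxE; congr _%:~R; have := eqc i; rewrite !ffunE.
  move/(congr1 val); rewrite /= !inordK ?(box_code_bound (by_ _ _)) //.
    by apply: box_code_inj; [apply: by_|apply: by_'].
  exact/box_code_bound/by_'.
by move=> y; rewrite mem_filter => /andP[yout /mem_box_rows by_].
Qed.

Lemma pigeonhole (T U : finType) (h : T -> U) (E : {pred U}) (x1 : T) :
  (forall x, h x \in E) ->
  exists x0, (#|T| <= #|[pred x | h x == h x0]| * #|E|)%N.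
Proof.
move=> hE; pose w x := #|[pred z | h z == h x]|.
have [x0 _ xmax] := @arg_maxnP _ x1 xpredT w isT; exists x0.
have -> : #|T| = (\sum_(e in E) \sum_(x | h x == e) 1)%N.
  by rewrite -sum1_card (partition_big h (mem E)) //=.
rewrite mulnC -sum_nat_const.
apply: leq_sum => e _; case: (pickP (fun x => h x == e)) => [x /eqP hx|none].
  by apply: leq_trans (xmax x isT); rewrite sum1_card /w hx.
by rewrite big_pred0.
Qed.

(** The [(b + 1) ^ d] vectors with entries in [[0, b]] fall into at most
    [p ^ (d - t)] classes modulo the span; the differences of the elements of a
    largest class with one of them lie in the box and in the span. *)
Lemma rows_inside_span p b d m (Y : 'M[int]_(m, d)) :
  prime p ->
  exists s : seq 'rV[int]_d,
    [/\ uniq s, (0 < size s)%N, (b ^ d <= size s * p ^ (d - rank_mod p Y))%N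
      & {in s, forall y, in_box b y /\ (Fpmx p y <= Fpmx p Y)%MS}].
Proof.
move=> pp; set t := rank_mod p Y.
have [g [Psi [gPsi patY]]] := pivot_factor (erefl t : \rank (Fpmx p Y) = t).
pose inside (y : 'rV[int]_d) := (Fpmx p y <= Fpmx p Y)%MS.
pose s := [seq y <- box_rows b d | inside y].
have ins y : (y \in s) = (y \in box_rows b d) && inside y.
  by rewrite mem_filter andbC.
have us : uniq s by rewrite filter_uniq // box_rows_uniq.
exists s; split=> //; last by move=> y; rewrite ins => /andP[/mem_box_rows].
  suff : 0 \in s by case: (s).
  rewrite ins; apply/andP; split; first by apply/mem_box_rows => i j; rewrite mxE.
  by rewrite /inside map_mx0 sub0mx.
pose row (v : {ffun 'I_d -> 'I_b.+1}) : 'rV[int]_d := \row_j (v j : nat)%:Z.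
pose h v : {ffun 'I_d -> 'F_p} :=
  [ffun j => (Fpmx p (row v) *m pattern_defect g Psi) 0 j].
pose E := (family (fun j => if j \in codom g then pred1 0 else predT)
            : {pred {ffun 'I_d -> 'F_p}}).
have cE : #|E| = (p ^ (d - t))%N.
  by rewrite card_family_zero_on // card_codom ?card_ord //; apply: pattern_inj gPsi.
have hE v : h v \in E.
  apply/familyP => j; rewrite ffunE; case: ifP => [/codomP[i ->]|//].
  rewrite inE mul_pattern_defect.
  have /matrixP/(_ 0 i) :
      colsub g (Fpmx p (row v) - colsub g (Fpmx p (row v)) *m Psi) = 0.
    rewrite -mul_pattern_defect -mulmx_colsub.
    suff -> : colsub g (pattern_defect g Psi) = 0 by rewrite mulmx0.
    have -> : colsub g (pattern_defect g Psi) =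
        colsub g 1%:M - colsub g (colsub g 1%:M *m Psi).
      by apply/matrixP => a c; rewrite !mxE.
    by rewrite -mulmx_colsub gPsi mulmx1 subrr.
  by rewrite !mxE => ->.
have [v0] := pigeonhole [ffun=> ord0] hE.
rewrite cE card_ffun !card_ord => pig.
apply: (leq_trans (n := (b.+1 ^ d)%N)); first by case: (d) => // d'; rewrite leq_exp2r.
apply: leq_trans pig _; rewrite leq_mul2r; apply/orP; right.
rewrite cardE -(size_map (fun v => row v - row v0)); apply: uniq_leq_size.
  rewrite map_inj_uniq ?enum_uniq // => v w /addIr/rowP vw; apply/ffunP => j.
  by apply: val_inj; have := vw j; rewrite !mxE => -[].
move=> y /mapP[v]; rewrite mem_enum inE => /eqP/ffunP hv -> {y}.
rewrite ins; apply/andP; split.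
  apply/mem_box_rows => i j; rewrite !mxE.
  exact: dist_below_bound.
apply/(pattern_submx _ (erefl t : \rank (Fpmx p Y) = t) gPsi patY)/row_patternP.
rewrite map_mxB mulmxBl; apply/eqP; rewrite subr_eq0; apply/eqP/rowP => j.
by have := hv j; rewrite !ffunE.
Qed.

(** The two estimates on the size of [s'] are kept together because the
    number of rows available in the span is bounded below both by 1 and by a
    quotient that may be smaller than 1. *)
Lemma extend_by_row p d m b t t' c q (s : seq 'M[int]_(m, d)) :
  uniq s -> {in s, forall Y, in_box b Y /\ rank_mod p Y = t} ->
  (forall Y : 'M[int]_(m, d), rank_mod p Y = t -> exists e : seq 'rV[int]_d,
     [/\ uniq e, (0 < size e)%N, (c <= size e * q)%N
       & {in e, forall y, in_box b y /\ rank_mod p (col_mx y Y) = t'}]) ->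
  exists s' : seq 'M[int]_(1 + m, d),
    [/\ uniq s', (size s <= size s')%N, (size s * c <= size s' * q)%N
      & {in s', forall Y, in_box b Y /\ rank_mod p Y = t'}].
Proof.
move=> us sP extP.
have /choice[e eP] : forall Y, exists e : seq 'rV[int]_d, Y \in s ->
    [/\ uniq e, (0 < size e)%N, (c <= size e * q)%N
      & {in e, forall y, in_box b y /\ rank_mod p (col_mx y Y) = t'}].
  move=> Y; case: (boolP (Y \in s)) => [/sP[_ /extP[e ?]]|_]; first by exists e.
  by exists [::].
exists [seq (col_mx y Y : 'M[int]_(1 + m, d)) | Y <- s, y <- e Y]; split.
- apply: allpairs_uniq_dep => // [Y /eP[]//|].
  by move=> [Y y] [Y' y'] _ _ /= /eq_col_mx[-> ->].
- rewrite size_allpairs_dep sumnE big_map -sum1_size big_seq [leqRHS]big_seq.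
  by apply: leq_sum => Y /eP[].
- rewrite size_allpairs_dep sumnE big_map big_distrl /= -sum1_size big_distrl /=.
  rewrite big_seq [leqRHS]big_seq.
  by apply: leq_sum => Y /eP[_ _ ? _]; rewrite mul1n.
move=> _ /allpairsPdep[Y [y [Ys ye ->]]].
have [_ _ _ /(_ y ye)[by_ ry]] := eP _ Ys; split=> //.
have [bY _] := sP _ Ys; move=> i j.
by case: (split_ordP (i : 'I_(1 + m))) => i' ->; rewrite ?col_mxEu ?col_mxEd.
Qed.

Lemma rank_mod_col_mx p d m (y : 'rV[int]_d) (Y : 'M[int]_(m, d)) :
  rank_mod p (col_mx y Y) =
  (rank_mod p Y + ~~ (Fpmx p y <= Fpmx p Y)%MS)%N.
Proof.
rewrite /rank_mod map_col_mx -addsmxE; set u := map_mx _ y; set U := map_mx _ Y.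
case: (boolP (u <= U)%MS) => [uU|nuU] /=; first by rewrite addn0 (addsmx_idPr uU).
rewrite addn1; apply/eqP; rewrite eqn_leq; apply/andP; split.
  apply: leq_trans (mxrank_adds_leqif u U) _.
  by rewrite -[X in (_ <= X)%N]add1n leq_add2r rank_leq_row.
apply: rank_ltmx; rewrite ltmxE addsmxSr /= addsmx_sub negb_and.
by rewrite nuU.
Qed.

Lemma many_full_rank_boxes p b d t :
  prime p -> (0 < b)%N -> (b + b < p)%N -> (t <= d)%N ->
  exists s : seq 'M[int]_(t, d),
    [/\ uniq s, (b ^ (d * t) <= size s)%N
      & {in s, forall Y, in_box b Y /\ rank_mod p Y = t}].
Proof.
move=> pp b0 bp; elim: t => [|t IH] td.
  exists [:: 0]; split=> //; first by rewrite muln0.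
  move=> Y; rewrite inE => /eqP ->; split; first by case.
  by apply/eqP; rewrite -leqn0 rank_leq_row.
have [s [us sz sP]] := IH (ltnW td).
have [|s' [us' _ sz' sP']] := @extend_by_row p d t b t t.+1 (b ^ d) 1 s us sP.
  move=> Y rY; have rd : (rank_mod p Y < d)%N by rewrite rY.
  have [e [ue se eP]] := rows_outside_span pp b0 bp rd.
  exists e; split=> //; rewrite ?muln1 //.
    by apply: leq_trans se; rewrite expn_gt0 b0.
  by move=> y /eP[by_ out]; rewrite rank_mod_col_mx out rY addn1.
exists s'; split=> //; rewrite muln1 in sz'.
by apply: leq_trans sz'; rewrite mulnS addnC expnD leq_mul2r sz orbT.
Qed.

Lemma many_boxes_of_rank p b d t m :
  prime p -> (0 < b)%N -> (b + b < p)%N -> (t <= d)%N ->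
  exists s : seq 'M[int]_(m + t, d),
    [/\ uniq s, (b ^ (d * t) <= size s)%N,
        (b ^ (d * (m + t)) <= size s * p ^ ((d - t) * m))%N
      & {in s, forall Y, in_box b Y /\ rank_mod p Y = t}].
Proof.
move=> pp b0 bp td; elim: m => [|m [s [us sz szp sP]]].
  have [s [us sz sP]] := many_full_rank_boxes pp b0 bp td.
  by exists s; split=> //; rewrite muln0 muln1.
have [|s' [us' sz' szp' sP']] :=
  @extend_by_row p d (m + t) b t t (b ^ d) (p ^ (d - t)) s us sP.
  move=> Y rY; have [e [ue se szp' eP]] := rows_inside_span b Y pp.
  exists e; split=> //; first by rewrite rY in szp'.
  by move=> y /eP[by_ into]; rewrite rank_mod_col_mx into rY addn0.
exists s'; split=> //; first exact: leq_trans sz sz'.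
have -> : (b ^ (d * (m.+1 + t)) = b ^ (d * (m + t)) * b ^ d)%N.
  by rewrite addSn mulnS addnC expnD.
rewrite mulnS expnD mulnA.
apply: leq_trans (leq_mul szp' (leqnn (p ^ ((d - t) * m)))).
by rewrite mulnAC leq_mul2r szp orbT.
Qed.

Lemma in_box_mx_norm b d n (X : 'M[int]_(d, n)) :
  mx_norm X <= b%:Z <-> in_box b X.
Proof.
split=> [bX i j|bX].
  apply: le_trans bX; rewrite mx_normrE.
  exact: (le_bigmax _ (fun ij : 'I_d * 'I_n => `|X ij.1 ij.2|) (i, j)).
by rewrite mx_normrE; apply: bigmax_le => // ij _; apply: bX.
Qed.

Lemma mem_bounded_rank_mod d n r p b (X : 'M[int]_(d, n)) :
  X \in fset_set (@bounded_rank_mod d n r p b) <-> in_box b X /\ rank_mod p X = r.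
Proof.
rewrite in_fset_set; last exact: finite_bounded_rank_mod.
split=> [/set_mem[/in_box_mx_norm]//|[bX rX]].
by apply/mem_set; split=> //; apply/in_box_mx_norm.
Qed.

(** * Order of magnitude of the count *)

Unset Implicit Arguments.

Theorem theorem8p10 (R : realType) (d : nat) :
  exists c C : R, 0 < c /\ 0 < C /\
    forall n r : nat, (1 <= r)%N -> (r < n)%N -> (n < d)%N ->
    forall p b : nat, prime p -> (1 <= b)%N -> b%:R <= (p%:R - 1) / 2 :> R ->
      let M := Num.max (b%:R ^+ (d * r))
                 (b%:R ^+ (d * n) * p%:R ^- ((d - r) * (n - r))) : R in
      c * M <= (N_pb d n r p b)%:R /\ (N_pb d n r p b)%:R <= C * M.
Proof.
(* The successor keeps the second constant positive when [d] is 0. *)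
exists 1, ((d * uniform_constant d).+1%:R); split; first exact: ltr01.
split; first by rewrite ltr0n.
move=> n r r1 rn nd p b pp b0 bp M.
have b2p : (b + b < p)%N.
  rewrite -(ltr_nat R) natrD; move: bp; lra.
pose s : seq 'M[int]_(d, n) := fset_set (@bounded_rank_mod d n r p b).
have sP : {in s, forall X, in_box b X /\ rank_mod p X = r}.
  by move=> X /mem_bounded_rank_mod.
split.
  rewrite mul1r ge_max.
  have := @many_boxes_of_rank p b d r (n - r) pp b0 b2p (ltnW (ltn_trans rn nd)).
  rewrite subnK; last exact: ltnW.
  move=> [l [ul szl szlp lP]].
  have le_N : (size l <= N_pb d n r p b)%N.
    rewrite -(size_map trmx); apply: uniq_leq_size.
      by rewrite map_inj_uniq //; apply: trmx_inj.
    move=> _ /mapP[Y /lP[bY rY] ->]; apply/mem_bounded_rank_mod; split.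
      by move=> i j; rewrite mxE; apply: bY.
    by rewrite /rank_mod -map_trmx mxrank_tr.
  rewrite -!natrX ler_nat (leq_trans szl le_N) /=.
  rewrite ler_pdivrMr ?ltr0n ?expn_gt0 ?prime_gt0 //.
  by rewrite -natrM ler_nat (leq_trans szlp) // leq_mul2r le_N orbT.
apply: le_trans (@rank_mod_count_upper R p d n r b s pp b0 rn nd (fset_uniq _) sP) _.
by rewrite ler_wpM2r ?ler_nat // le_max exprn_ge0.
Qed.
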